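(* For $k>0$ let $$B_k(v,y,x)=\sum_{n\ge0}\sum_{\pi\in\mathfrak M_n(12\ldots(k+1))}v^{\mathrm{lds}(\pi)}y^{\#\{\text{rises of }\pi\}}x^n.$$ Then $B_1(v,y,x)=\frac{1}{1-vx}$ and, for $k>1$, $$B_k(v,y,x)=\frac{1}{1-vx-vyx^2B_{k-1}(v,y,x)}.$$ Thus $B_k$ is the continued fraction $$B_k(v,y,x)=\cfrac{1}{1-vx-\cfrac{vyx^2}{1-vx-\cfrac{vyx^2}{\ddots-\cfrac{vyx^2}{1-vx}}}}$$ with $k$ levels, and $$B_k(v,y,x)=\frac{U_{k-1}\left(\frac{1-vx}{2x\sqrt{vy}}\right)}{x\sqrt{vy}\,U_k\left(\frac{1-vx}{2x\sqrt{vy}}\right)}.$$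
   Context: A permutation $\pi=\pi_1\cdots\pi_n$ is a Motzkin permutation if it avoids the pattern $132$ (no $i<j<k$ with $\pi_i<\pi_k<\pi_j$) and there are no indices $a<b$ with $\pi_a<\pi_b<\pi_{b+1}$; $\mathfrak M_n$ is the set of Motzkin permutations of length $n$, and $\mathfrak M_n(12\ldots(k+1))$ is the subset of those having no increasing subsequence of length $k+1$. $\mathrm{lds}(\pi)$ is the length of the longest decreasing subsequence; a rise is an index $i$ with $\pi_i<\pi_{i+1}$. $U_r$ denotes the Chebyshev polynomial of the second kind, $U_r(\cos\theta)=\sin((r+1)\theta)/\sin\theta$, satisfying $U_0(t)=1$, $U_1(t)=2t$, $U_r(t)=2tU_{r-1}(t)-U_{r-2}(t)$. *)

(* Defs.v *)
From HB Require Import structures.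
From mathcomp Require Import all_boot all_order all_algebra all_fingroup all_field.
From mathcomp Require Import boolp.
From mathcomp Require Import mpoly ring.
Set Implicit Arguments.
Unset Strict Implicit.
Unset Printing Implicit Defensive.
Import GRing.Theory.
Local Open Scope ring_scope.

(* Formal power series in one variable x: the coefficient of x^n in p is p n. *)
Record fps (R : Type) := FPS { fps_coef :> nat -> R }.

Lemma fpsP (R : Type) (p q : fps R) : p =1 q -> p = q.
Proof. by case: p q => [p] [q] /= /funext ->. Qed.

HB.instance Definition _ (R : Type) := gen_eqMixin (fps R).
HB.instance Definition _ (R : Type) := gen_choiceMixin (fps R).

Section FpsZmod.
Variable R : zmodType.
Implicit Types p q : fps R.

Definition fps_zero : fps R := FPS (fun=> 0).
Definition fps_opp p : fps R := FPS (fun n => - p n).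
Definition fps_add p q : fps R := FPS (fun n => p n + q n).

Fact fps_addA : associative fps_add.
Proof. by move=> p q r; apply: fpsP => n /=; rewrite addrA. Qed.
Fact fps_addC : commutative fps_add.
Proof. by move=> p q; apply: fpsP => n /=; rewrite addrC. Qed.
Fact fps_add0 : left_id fps_zero fps_add.
Proof. by move=> p; apply: fpsP => n /=; rewrite add0r. Qed.
Fact fps_addN : left_inverse fps_zero fps_opp fps_add.
Proof. by move=> p; apply: fpsP => n /=; rewrite addNr. Qed.

HB.instance Definition _ :=
  GRing.isZmodule.Build (fps R) fps_addA fps_addC fps_add0 fps_addN.

Lemma fps_coef0 n : (0 : fps R) n = 0. Proof. by []. Qed.
Lemma fps_coefD p q n : (p + q) n = p n + q n. Proof. by []. Qed.
Lemma fps_coefN p n : (- p) n = - p n. Proof. by []. Qed.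
Lemma fps_coefB p q n : (p - q) n = p n - q n. Proof. by []. Qed.
End FpsZmod.

Section FpsRing.
Variable R : comNzRingType.
Implicit Types p q : fps R.

Definition fps_const (c : R) : fps R := FPS (fun n => if n == 0%N then c else 0).
Definition fps_x : fps R := FPS (fun n => (n == 1%N)%:R).
Definition fps_mul p q : fps R :=
  FPS (fun n => \sum_(i < n.+1) p i * q (n - i)%N).

Let trunc m p : {poly R} := \poly_(i < m.+1) p i.

Let truncM m p q n : (n <= m)%N -> (trunc m p * trunc m q)`_n = fps_mul p q n.
Proof.
move=> le_nm; rewrite coefM; apply: eq_bigr => i _.
by rewrite !coef_poly !ltnS (leq_trans (leq_subr _ _) le_nm)
           (leq_trans _ le_nm) // -ltnS.
Qed.

Fact fps_mulC : commutative fps_mul.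
Proof.
move=> p q; apply: fpsP => n.
by rewrite -!(@truncM n) // mulrC.
Qed.

Fact fps_mulA : associative fps_mul.
Proof.
move=> p q r; apply: fpsP => n.
have coefL p1 q1 r1 :
    fps_mul (fps_mul p1 q1) r1 n = (trunc n p1 * trunc n q1 * trunc n r1)`_n.
  rewrite coefM; apply: eq_bigr => i _.
  have le_in : (i <= n)%N by rewrite -ltnS.
  by rewrite truncM // coef_poly ltnS leq_subr.
rewrite [LHS](congr1 (fun f : fps R => f n) (fps_mulC _ _)) !coefL.
by rewrite mulrC mulrA.
Qed.

Fact fps_mul1 : left_id (fps_const 1) fps_mul.
Proof.
move=> p; apply: fpsP => n /=.
rewrite big_ord_recl big1 => [|i _]; last by rewrite /= mul0r.
by rewrite /= mul1r subn0 addr0.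
Qed.

Fact fps_mulDl : left_distributive fps_mul +%R.
Proof.
move=> p q r; apply: fpsP => n /=.
by rewrite -big_split; apply: eq_bigr => i _; rewrite mulrDl.
Qed.

Fact fps_nz : fps_const 1 != 0.
Proof.
by apply/eqP => /(congr1 (fun p : fps R => p 0%N)) /eqP; rewrite /= oner_eq0.
Qed.

HB.instance Definition _ := GRing.Zmodule_isComNzRing.Build (fps R)
  fps_mulA fps_mulC fps_mul1 fps_mulDl fps_nz.

Lemma fps_coef1 n : (1 : fps R) n = (n == 0%N)%:R. Proof. by case: n. Qed.
Lemma fps_coefM p q n : (p * q) n = \sum_(i < n.+1) p i * q (n - i)%N.
Proof. by []. Qed.
End FpsRing.

Arguments fps_x {R}.

Definition fps_map (R S : Type) (f : R -> S) (p : fps R) : fps S :=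
  FPS (fun n => f (p n)).

(* A series is invertible iff its constant term is, and the coefficients of the
   inverse are computed recursively; as everywhere in MathComp, p^-1 = p when p
   is not invertible. *)
Section FpsUnit.
Variable R : comUnitRingType.
Implicit Types p q : fps R.

Fixpoint fps_inv_seq p n : seq R :=
  if n is m.+1 then
    let s := fps_inv_seq p m in
    rcons s (- (p 0%N)^-1 * \sum_(i < m.+1) s`_i * p (m.+1 - i)%N)
  else [:: (p 0%N)^-1].

Definition fps_unit : pred (fps R) := fun p => p 0%N \is a GRing.unit.

Definition fps_inv p : fps R :=
  if fps_unit p then FPS (fun n => (fps_inv_seq p n)`_n) else p.

Let size_inv_seq p n : size (fps_inv_seq p n) = n.+1.
Proof. by elim: n => //= n IHn; rewrite size_rcons IHn. Qed.

Let nth_inv_seq p n i : (i <= n)%N -> (fps_inv_seq p n)`_i = (fps_inv_seq p i)`_i.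
Proof.
elim: n => [|n IHn]; first by rewrite leqn0 => /eqP ->.
rewrite leq_eqVlt => /orP[/eqP -> //|lt_in].
by rewrite /= nth_rcons size_inv_seq lt_in IHn.
Qed.

Fact fps_mulV : {in fps_unit, left_inverse 1 fps_inv *%R}.
Proof.
move=> p Up; apply: fpsP => n.
have Up0 : p 0%N \is a GRing.unit by [].
rewrite fps_coef1 fps_coefM /fps_inv ifT //= big_ord_recr subnn /=.
case: n => [|n]; first by rewrite big_ord0 add0r mulVr.
rewrite /= nth_rcons size_inv_seq ltnn eqxx mulrAC mulNr mulVr // mulN1r.
apply/eqP; rewrite subr_eq0; apply/eqP; apply: eq_bigr => i _.
by rewrite [in RHS](@nth_inv_seq p n i) // -ltnS.
Qed.

Fact fps_unitPl p q : q * p = 1 -> fps_unit p.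
Proof.
move=> /(congr1 (fun r : fps R => r 0%N)).
rewrite fps_coefM big_ord1 fps_coef1 => qp1.
by apply/unitrPr; exists (q 0%N); rewrite mulrC.
Qed.

Fact fps_inv_out : {in [predC fps_unit], fps_inv =1 id}.
Proof. by move=> p /negPf Up; rewrite /fps_inv ifF. Qed.

HB.instance Definition _ := GRing.ComNzRing_hasMulInverse.Build (fps R)
  fps_mulV fps_unitPl fps_inv_out.

Lemma fps_unitE p : (p \is a GRing.unit) = (p 0%N \is a GRing.unit).
Proof. by []. Qed.
End FpsUnit.

Section FpsIdomain.
Variable R : idomainType.
Implicit Types p q : fps R.

Let fps_order p : p != 0 -> {n | p n != 0 & forall m, (m < n)%N -> p m = 0}.
Proof.
move=> nz_p.
have exn : exists n, p n != 0.
  apply: contrapT => /forallNP no; case/eqP: nz_p; apply: fpsP => n.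
  by have /negP := no n; rewrite negbK => /eqP.
case: (ex_minnP exn) => n pn min_n; exists n => // m lt_mn.
by apply/eqP; apply: contraTT lt_mn => /min_n; rewrite -leqNgt.
Qed.

Fact fps_mulf_eq0 p q : p * q = 0 -> (p == 0) || (q == 0).
Proof.
move=> pq0; apply/norP => -[/fps_order[m pm minp] /fps_order[n qn minq]].
have /eqP : (p * q) (m + n)%N = 0 by rewrite pq0.
have lt_m : (m < (m + n).+1)%N by rewrite ltnS leq_addr.
rewrite fps_coefM (bigD1 (Ordinal lt_m)) //= big1 => [|i ne_im].
  by rewrite addr0 addKn mulf_eq0 (negPf pm) (negPf qn).
have [lt_im|lt_mi|eq_im] := ltngtP i m; first by rewrite minp ?mul0r.
  rewrite [q _]minq ?mulr0 //.
  by rewrite ltn_subLR ?ltn_add2r // -ltnS; case: i {ne_im lt_mi}.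
by case/eqP: ne_im; apply: val_inj.
Qed.

HB.instance Definition _ :=
  GRing.ComUnitRing_isIntegral.Build (fps R) fps_mulf_eq0.
End FpsIdomain.

Section Permutations.
Variable n : nat.
Implicit Type s : 'S_n.

Definition avoids132 s : bool :=
  [forall i : 'I_n, forall j : 'I_n, forall k : 'I_n,
     ~~ [&& (i < j)%N, (j < k)%N, (s i < s k)%N & (s k < s j)%N]].

(* The index c stands for b + 1. *)
Definition avoids1_23 s : bool :=
  [forall a : 'I_n, forall b : 'I_n, forall c : 'I_n,
     ~~ [&& (a < b)%N, c == b.+1 :> nat, (s a < s b)%N & (s b < s c)%N]].

Definition motzkin s : bool := avoids132 s && avoids1_23 s.

(* A subsequence is given by the set A of the positions of its entries. *)
Definition increasing_on s (A : {set 'I_n}) : bool :=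
  [forall i in A, forall j in A,
     (i < j)%N ==> (s i < s j)%N].
Definition decreasing_on s (A : {set 'I_n}) : bool :=
  [forall i in A, forall j in A,
     (i < j)%N ==> (s j < s i)%N].

Definition has_increasing s (m : nat) : bool :=
  [exists A : {set 'I_n}, (#|A| == m) && increasing_on s A].

Definition lds s : nat := \max_(A : {set 'I_n} | decreasing_on s A) #|A|.

Definition rises s : nat :=
  #|[set i : 'I_n | [exists j : 'I_n, (j == i.+1 :> nat) && (s i < s j)%N]]|.
End Permutations.

(* The coefficient ring of the generating function is Z[v, y]. *)
Notation Zvy := {mpoly int[2]}.
Definition v : Zvy := 'X_0.
Definition y : Zvy := 'X_1.

Definition B (k : nat) : fps Zvy :=
  FPS (fun n => \sum_(s : 'S_n | motzkin s && ~~ has_increasing s k.+1)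
                  v ^+ lds s * y ^+ rises s).

(* a - b / (a - b / (... - b / a)), where a occurs m + 1 times. *)
Fixpoint nested_frac (R : unitRingType) (a b : R) (m : nat) : R :=
  if m is m'.+1 then a - b / nested_frac a b m' else a.

Fixpoint chebyshevU (R : nzRingType) (r : nat) : {poly R} :=
  if r is r1.+1 then
    if r1 is r2.+1 then 2%:R *: 'X * chebyshevU R r1 - chebyshevU R r2
    else 2%:R *: 'X
  else 1.

(* With z = exp(i theta), this is U_r(cos theta) = sin((r+1) theta)/sin theta. *)
Lemma chebyshevU_sin (F : fieldType) (z : F) (r : nat) :
  z != 0 -> (2%:R : F) != 0 ->
  (chebyshevU F r).[(z + z^-1) / 2%:R] * (z - z^-1) = z ^+ r.+1 - z ^- r.+1.
Proof.
move=> nz_z nz_2; set t := _ / _.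
have t2 : 2%:R * t = z + z^-1 by rewrite mulrC divfK.
suff: (chebyshevU F r).[t] * (z - z^-1) = z ^+ r.+1 - z ^- r.+1 /\
      (chebyshevU F r.+1).[t] * (z - z^-1) = z ^+ r.+2 - z ^- r.+2 by case.
elim: r => [|r [IH0 IH1]].
  split; first by rewrite /= hornerC mul1r !expr1.
  by rewrite /= hornerZ hornerX t2 mulrC -subr_sqr exprVn.
split=> //; rewrite [chebyshevU F r.+2]/= -/(chebyshevU F r.+1).
rewrite hornerD hornerN hornerM hornerZ hornerX t2 mulrBl -mulrA IH0 IH1.
rewrite -!exprVn; set w := z^-1.
have zw : z * w = 1 by rewrite divff.
have -> : (z + w) * (z ^+ r.+2 - w ^+ r.+2) - (z ^+ r.+1 - w ^+ r.+1) =
  z ^+ r.+3 - w ^+ r.+3 + (z * w - 1) * (z ^+ r.+1 - w ^+ r.+1).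
  by rewrite !exprS; ring.
by rewrite zw subrr mul0r addr0.
Qed.

(* Z[v, y] embeds in a field in which v y has a square root. *)
Lemma sqrt_vy_exists :
  exists (L : fieldType) (f : {rmorphism Zvy -> L}) (q : L),
    injective f /\ q ^+ 2 = f (v * y).
Proof.
pose F := {fraction Zvy}; pose c : F := tofrac (v * y).
have inj_tofrac : injective (@tofrac Zvy).
  by move=> p q /eqP; rewrite tofrac_eq => /eqP.
have [[q Dq]|no_root] := pselect (exists q : F, q ^+ 2 = c).
  by exists F, (@tofrac Zvy), q.
pose p : {poly F} := 'X^2 - c%:P.
have sz_p : size p = 3 by rewrite size_XnsubC.
have irr_p : irreducible_poly p.
  apply: cubic_irreducible; rewrite ?sz_p // => x.
  apply/negP; rewrite rootE !hornerE subr_eq0 => /eqP Dx.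
  by apply: no_root; exists x.
have [L _ [q]] := irredp_FAdjoin irr_p.
rewrite rootE rmorphB /= map_polyXn map_polyC !hornerE subr_eq0 => /eqP Dq _.
exists L, (in_alg L \o @tofrac Zvy), q; split=> //.
by apply: inj_comp inj_tofrac; apply: fmorph_inj.
Qed.

(* Main.v *)
(* Let [n] be the maximum of a nonempty Motzkin word.  Avoiding 132 puts every entry
   before [n] above every entry after it.  If [n] is not the first entry, avoiding
   1-23 forces its left neighbour [m] to be the least entry before [n].  So the word
   is either [n w2] or [w1 m n w2] with [w1 > m > w2], where [w1] and [w2] are
   arbitrary Motzkin words up to a shift; the second form contributes one more
   rise, and increases the longest increasing subsequence of [w1] by one.  Hence
   [B k = 1 + v x (B k) + v y x^2 (B k.-1) (B k)] for [k > 1], without the last term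
   for [k = 1]. *)
Require Import Defs.
From mathcomp Require Import all_boot all_order all_algebra all_fingroup all_field.
From mathcomp Require Import mpoly zify ring.
Import GRing.Theory.
Set Implicit Arguments.
Unset Strict Implicit.
Unset Printing Implicit Defensive.

(** * Longest sorted subsequences of a word *)

Lemma subseq_catP (T : eqType) (u w1 w2 : seq T) :
  reflect (exists u1 u2, [/\ subseq u1 w1, subseq u2 w2 & u = u1 ++ u2])
          (subseq u (w1 ++ w2)).
Proof.
apply: (iffP idP) => [/subseqP[m sz_m ->]|[u1 [u2 [s1 s2 ->]]]]; last first.
  exact: cat_subseq.
exists (mask (take (size w1) m) w1), (mask (drop (size w1) m) w2).
rewrite !mask_subseq -mask_cat ?cat_take_drop //.
by rewrite size_takel // sz_m size_cat leq_addr.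
Qed.

(** Bit masks form a finite type, so a maximum over subsequences makes sense. The relation [ltn]
    gives increasing subsequences, [gtn] decreasing ones. *)
Definition longest (r : rel nat) (w : seq nat) : nat :=
  \max_(m : (size w).-tuple bool | sorted r (mask m w)) size (mask m w).

Lemma longest_ge (r : rel nat) (u w : seq nat) :
  subseq u w -> sorted r u -> size u <= longest r w.
Proof.
case/subseqP=> m /eqP sz_m -> sort_m.
exact: (@leq_bigmax_cond _ _ (fun m : (size w).-tuple bool => size (mask m w))
  (Tuple sz_m)).
Qed.

Lemma longest_ex (r : rel nat) (w : seq nat) :
  exists u, [/\ subseq u w, sorted r u & size u = longest r w].
Proof.
have [|m sort_m Dm] := @eq_bigmax_cond _
  [pred m : (size w).-tuple bool | sorted r (mask m w)]
  (fun m : (size w).-tuple bool => size (mask m w)).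
  by apply/card_gt0P; exists (nseq_tuple (size w) false); rewrite inE mask_false.
by exists (mask m w); rewrite mask_subseq /longest Dm.
Qed.

Lemma longest_leP (r : rel nat) (w : seq nat) (d : nat) :
  (forall u, subseq u w -> sorted r u -> size u <= d) -> longest r w <= d.
Proof. by move=> le_d; have [u [su ru <-]] := longest_ex r w; apply: le_d. Qed.

Lemma longest_mono (r : rel nat) (w1 w2 : seq nat) :
  subseq w1 w2 -> longest r w1 <= longest r w2.
Proof.
move=> s12; apply: longest_leP => u su; apply: longest_ge.
exact: subseq_trans s12.
Qed.

Lemma longest_map (r : rel nat) (f : nat -> nat) (w : seq nat) :
  {mono f : a b / r a b} -> longest r (map f w) = longest r w.
Proof.
move=> fr; apply/eqP; rewrite eqn_leq; apply/andP; split.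
  apply: longest_leP => _ /subseqP[m sz_m ->]; rewrite -map_mask size_map.
  by rewrite (mono_sorted fr); apply/longest_ge/mask_subseq.
have [u [su ru <-]] := longest_ex r w; rewrite -(size_map f).
by apply: longest_ge; rewrite ?map_subseq ?(mono_sorted fr).
Qed.

Lemma longest_nil (r : rel nat) : longest r [::] = 0.
Proof.
by apply/eqP; rewrite -leqn0; apply: longest_leP => u; rewrite subseq0 => /eqP->.
Qed.

Lemma longest_seq1 (r : rel nat) (a : nat) : longest r [:: a] = 1.
Proof.
apply/eqP; rewrite eqn_leq (@longest_ge r [:: a]) // andbT.
by apply: longest_leP => u /size_subseq.
Qed.

Lemma longest_cat_le (r : rel nat) (w1 w2 : seq nat) :
  longest r (w1 ++ w2) <= longest r w1 + longest r w2.
Proof.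
apply: longest_leP => _ /subseq_catP[u1 [u2 [s1 s2 ->]]] /cat_sorted2[r1 r2].
by rewrite size_cat leq_add ?longest_ge.
Qed.

Lemma sorted_cat_cons_rel (T : eqType) (r : rel T) (b : T) (w1 w2 : seq T) :
  {in w1, forall a, r a b} ->
  sorted r (w1 ++ b :: w2) = sorted r w1 && path r b w2.
Proof.
by case: w1 => [//|a w1] r1; rewrite /= cat_path /= r1 // mem_last.
Qed.

Lemma sorted_cat_rel (T : eqType) (r : rel T) (w1 w2 : seq T) :
  {in w1 & w2, forall a b, r a b} ->
  sorted r (w1 ++ w2) = sorted r w1 && sorted r w2.
Proof.
case: w2 => [|b w2] r12; first by rewrite cats0 andbT.
by apply: sorted_cat_cons_rel => a a_w1; rewrite r12 ?mem_head.
Qed.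

(** A sorted subsequence of [w1] followed by one of [w2] is again sorted. *)
Lemma longest_cat_rel (r : rel nat) (w1 w2 : seq nat) :
  {in w1 & w2, forall a b, r a b} ->
  longest r (w1 ++ w2) = longest r w1 + longest r w2.
Proof.
move=> r12; apply/eqP; rewrite eqn_leq longest_cat_le /=.
have [u1 [s1 ru1 <-]] := longest_ex r w1.
have [u2 [s2 ru2 <-]] := longest_ex r w2.
rewrite -size_cat longest_ge ?cat_subseq // sorted_cat_rel ?ru1 // => a b ua ub.
by rewrite r12 // ?(mem_subseq s1) ?(mem_subseq s2).
Qed.

(** By transitivity, a sorted subsequence meeting both parts would relate an entry of [w1] to one of
    [w2]; hence it lies within one part. *)
Lemma longest_cat_nrel (r : rel nat) (w1 w2 : seq nat) :
  transitive r -> {in w1 & w2, forall a b, ~~ r a b} ->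
  longest r (w1 ++ w2) = maxn (longest r w1) (longest r w2).
Proof.
move=> r_tr nr12; apply/eqP; rewrite eqn_leq geq_max.
rewrite !longest_mono ?prefix_subseq ?suffix_subseq // !andbT.
apply: longest_leP => _ /subseq_catP[u1 [u2 [s1 s2 ->]]] r_u.
have [r1 r2] := cat_sorted2 r_u; rewrite leq_max.
case: u1 u2 => [|a u1] [|b u2] in s1 s2 r_u r1 r2 *.
- by [].
- by rewrite (longest_ge s2) ?orbT.
- by rewrite cats0 (longest_ge s1).
have /negP[] := nr12 a b (mem_subseq s1 (mem_head _ _)) (mem_subseq s2 (mem_head _ _)).
move: r_u; rewrite /= path_sortedE // all_cat /=.
by case/andP=> /andP[_ /andP[]].
Qed.

(** * Rises and the Motzkin condition on words *)

Definition rises_word (w : seq nat) : nat :=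
  \sum_(0 <= i < (size w).-1) (nth 0 w i < nth 0 w i.+1).

Lemma rises_word_cons2 (a b : nat) (w : seq nat) :
  rises_word (a :: b :: w) = (a < b) + rises_word (b :: w).
Proof. by rewrite /rises_word /= big_nat_recl. Qed.

Lemma rises_word_seq1 (a : nat) : rises_word [:: a] = 0.
Proof. by rewrite /rises_word big_nil. Qed.

Lemma rises_word_nil : rises_word [::] = 0.
Proof. by rewrite /rises_word big_nil. Qed.

(** The junction between [w1] and [b] is a descent, so no rise appears there. *)
Lemma rises_word_cat_cons (b : nat) (w1 w2 : seq nat) :
  {in w1, forall a, b < a} ->
  rises_word (w1 ++ b :: w2) = rises_word w1 + rises_word (b :: w2).
Proof.
elim: w1 => [|a [|c w1] IH] w1b; first by rewrite rises_word_nil.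
  by rewrite rises_word_cons2 rises_word_seq1 ltnNge ltnW // w1b ?mem_head.
rewrite /= !rises_word_cons2 -addnA; congr addn.
by apply: IH => d d_w; rewrite w1b // inE d_w orbT.
Qed.

Lemma rises_word_cat (w1 w2 : seq nat) :
  {in w1 & w2, forall a b, b < a} ->
  rises_word (w1 ++ w2) = rises_word w1 + rises_word w2.
Proof.
case: w2 => [|b w2] w12; first by rewrite cats0 rises_word_nil addn0.
by apply: rises_word_cat_cons => a a_w1; rewrite w12 ?mem_head.
Qed.

Lemma rises_word_map (f : nat -> nat) (w : seq nat) :
  {mono f : a b / a < b} -> rises_word (map f w) = rises_word w.
Proof.
move=> f_mono; elim: w => [//|a [|b w] IH]; first by rewrite !rises_word_seq1.
by rewrite /= !rises_word_cons2 f_mono -IH.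
Qed.

(** Both patterns begin with their least entry, so each head [a] is tested as the 1: [pairwise]
    excludes 132 at any distance, while [sorted], which compares neighbours only, excludes 1-23. *)
Fixpoint motzkin_word (w : seq nat) : bool :=
  if w is a :: w' then
    [&& pairwise (fun b c => ~~ (a < c < b)) w',
        sorted (fun b c => ~~ (a < b < c)) w' & motzkin_word w']
  else true.

Lemma motzkin_word_map (f : nat -> nat) (w : seq nat) :
  {mono f : a b / a < b} -> motzkin_word (map f w) = motzkin_word w.
Proof.
move=> f_mono; elim: w => [//|a w IH]; rewrite /= IH pairwise_map sorted_map.
congr [&& _, _ & _]; [apply: eq_pairwise | apply: eq_sorted] => b c /=.
  by rewrite !f_mono.
by rewrite !f_mono.
Qed.

(** An occurrence starting in [w1] cannot reach [w2], whose entries are smaller than its 1; one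
    starting in [w2] stays there. *)
Lemma motzkin_word_cat (w1 w2 : seq nat) :
  {in w1 & w2, forall a b, b < a} ->
  motzkin_word (w1 ++ w2) = motzkin_word w1 && motzkin_word w2.
Proof.
elim: w1 => [//|a w1 IH] w12 /=.
have aw2 b : b \in w2 -> (a < b) = false.
  by move=> b_w2; apply: negbTE; rewrite -leqNgt ltnW // w12 ?mem_head.
have w12' : {in w1 & w2, forall c d, d < c}.
  by move=> c d c_w1 d_w2; rewrite w12 // inE c_w1 orbT.
rewrite IH // pairwise_cat sorted_cat_rel; last first.
  by move=> b c b_w1 c_w2; have := w12' b c b_w1 c_w2; lia.
have -> : pairwise (fun b c => ~~ (a < c < b)) w2.
  by apply/(pairwiseP 0) => i j lt_i lt_j _; rewrite aw2 ?mem_nth.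
have -> : sorted (fun b c => ~~ (a < b < c)) w2.
  by apply/(sortedP 0) => i lt_i; rewrite aw2 // mem_nth // ltnW.
have -> : allrel (fun b c => ~~ (a < c < b)) w1 w2.
  by apply/allrelP => b c _ c_w2; rewrite aw2.
by rewrite !andbT !andbA.
Qed.

(** The entry [m] is too small to be a 2 or a 3, and as a 1 it is followed by [n] alone. The last
    entry [n] is too large to be the 2 of 132, and as the 3 of 1-23 it would need its neighbour [m]
    as the 2. *)
Lemma motzkin_word_cat2 (w : seq nat) (m n : nat) :
  {in w, forall a, m < a < n} -> m < n ->
  motzkin_word (w ++ [:: m; n]) = motzkin_word w.
Proof.
elim: w => [//|a w IH] lt_mn_w lt_mn /=.
have lt_mn_w' : {in w, forall b, m < b < n}.
  by move=> b b_w; rewrite lt_mn_w // inE b_w orbT.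
have /andP[lt_ma lt_an] : m < a < n by rewrite lt_mn_w ?mem_head.
rewrite IH // pairwise_cat sorted_cat_cons_rel; last first.
  by move=> b /lt_mn_w'; lia.
have -> : allrel (fun b c => ~~ (a < c < b)) w [:: m; n].
  by apply/allrelP => b c /lt_mn_w' ? /[!inE] /orP[]/eqP->; lia.
have nan : ~~ (a < n < m) by lia.
have nam : ~~ (a < m < n) by lia.
by rewrite /= nan nam !andbT.
Qed.

(** Entries [a] before and [c] after [n] with [a < c] would form 132 with [n]; uniqueness excludes
    [a = c]. *)
Lemma motzkin_word_max (w1 w2 : seq nat) (n : nat) :
  uniq (w1 ++ w2) -> {in w1 ++ w2, forall a, a < n} ->
  motzkin_word (w1 ++ n :: w2) -> {in w1 & w2, forall a b, b < a}.
Proof.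
elim: w1 => [//|a w1 IH] /= /andP[aw12 uw12] lt_n /and3P[pw _ mw] b c.
rewrite inE => /predU1P[-> {b} c_w2|]; last first.
  by apply: IH => // d d_w; rewrite lt_n // inE d_w orbT.
move: pw; rewrite pairwise_cat /= => /and4P[_ _ /allP/(_ _ c_w2) nacn _].
have lt_cn : c < n by rewrite lt_n // inE mem_cat c_w2 !orbT.
have ne_ac : a != c.
  by apply: contraNneq aw12 => ->; rewrite mem_cat c_w2 orbT.
lia.
Qed.

(** An entry of [w1] below [m] would form 1-23 with the adjacent pair [m], [n]. *)
Lemma motzkin_word_min (w1 w2 : seq nat) (m n : nat) :
  m \notin w1 -> m < n ->
  motzkin_word (w1 ++ [:: m, n & w2]) -> {in w1, forall a, m < a}.
Proof.
move=> + lt_mn; elim: w1 => [//|a w1 IH] /=.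
rewrite inE negb_or => /andP[ne_ma mw1] /and3P[_ sw mw] b.
rewrite inE => /predU1P[-> {b}|]; last exact: IH.
have /cat_sorted2[_] := sw; rewrite /= => /andP[+ _]; lia.
Qed.

(** * Words over intervals, and gluing two words *)

Lemma perm_iota_split (a n : nat) (w1 w2 : seq nat) :
  perm_eq (w1 ++ w2) (iota a n) -> {in w1 & w2, forall b c, c < b} ->
  perm_eq w2 (iota a (size w2)) /\ perm_eq w1 (iota (a + size w2) (size w1)).
Proof.
move=> pw w12.
have sz : n = size w2 + size w1.
  by rewrite -(size_iota a n) -(perm_size pw) size_cat addnC.
(* As [w2] lies below [w1], sorting the parts separately and swapping them sorts the whole; cutting
   the interval at [size w2] then identifies each part. *)
have : sort leq w2 ++ sort leq w1 = iota a n.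
  apply: (sorted_eq leq_trans anti_leq); last 1 first.
  - by apply: perm_trans pw; rewrite perm_catC perm_cat // perm_sort.
  - rewrite sorted_cat_rel ?sort_sorted //; try exact: leq_total.
    by move=> b c; rewrite !mem_sort => b_w2 c_w1; rewrite ltnW // w12.
  - exact: iota_sorted.
rewrite sz iotaD => /eqP; rewrite eqseq_cat ?size_sort ?size_iota //.
by case/andP=> /eqP <- /eqP <-; rewrite ![perm_eq _ (sort _ _)]perm_sym !perm_sort.
Qed.

Lemma perm_iota_addP (a n : nat) (w : seq nat) :
  perm_eq w (iota a n) ->
  exists2 u, perm_eq u (iota 0 n) & w = [seq a + i | i <- u].
Proof.
move=> pw; exists [seq i - a | i <- w].
  have -> : iota 0 n = [seq i - a | i <- iota a n].
    rewrite -{2}[a]addn0 iotaDl -map_comp -[LHS]map_id.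
    by apply: eq_map => i /=; rewrite addKn.
  exact: perm_map.
rewrite -map_comp -[LHS]map_id; apply/eq_in_map => i.
by rewrite (perm_mem pw) mem_iota => /andP[le_ai _] /=; rewrite subnKC.
Qed.

(** The form [w1 m n w2] with [m = size u2]: [u2] takes the values below [m], and the shift lifts
    [u1] just above [m]. *)
Definition glue (n : nat) (u1 u2 : seq nat) : seq nat :=
  [seq (size u2).+1 + i | i <- u1] ++ [:: size u2; n] ++ u2.

Definition words (k n : nat) : seq (seq nat) :=
  [seq w <- permutations (iota 0 n) | motzkin_word w && (longest ltn w <= k)].

Lemma mem_words (k n : nat) (w : seq nat) :
  (w \in words k n) =
    [&& perm_eq w (iota 0 n), motzkin_word w & longest ltn w <= k].
Proof. by rewrite mem_filter mem_permutations andbC. Qed.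

(** * Effect of gluing on the Motzkin condition and the statistics *)

Section Glue.
Variables (w1 w2 : seq nat) (m n : nat).
Hypotheses (lt_mn : m < n) (w1_mn : {in w1, forall a, m < a < n}).
Hypothesis w2_m : {in w2, forall b, b < m}.

Let gt_w12 : {in w1 ++ [:: m; n] & w2, forall a b, b < a}.
Proof.
move=> a b + /w2_m lt_bm; rewrite mem_cat => /orP[/w1_mn|/[!inE] /orP[]/eqP->]; lia.
Qed.

Lemma motzkin_word_glue :
  motzkin_word (w1 ++ [:: m, n & w2]) = motzkin_word w1 && motzkin_word w2.
Proof.
by rewrite -(cat_cons m [:: n]) catA motzkin_word_cat // motzkin_word_cat2.
Qed.

(** Every increasing subsequence of [w1 ++ [:: m]] is prolonged by [n], and none continues into
    [w2]. The inner [1] is [m] alone, which matters when [w1] is empty. *)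
Lemma longest_ltn_glue :
  longest ltn (w1 ++ [:: m, n & w2]) =
    maxn (maxn (longest ltn w1) 1).+1 (longest ltn w2).
Proof.
rewrite -(cat_cons m [:: n]) catA longest_cat_nrel; last 2 first.
- exact: ltn_trans.
- by move=> a b a_w b_w; rewrite -leqNgt ltnW // gt_w12.
rewrite -cat1s catA longest_cat_rel; last first.
  by move=> a b + /[!inE] /eqP->; rewrite mem_cat => /orP[/w1_mn|/[!inE] /eqP->]; lia.
rewrite longest_cat_nrel ?longest_seq1 ?addn1 //; first exact: ltn_trans.
by move=> a b /w1_mn a_mn /[!inE] /eqP->; lia.
Qed.

(** A decreasing subsequence of [w1] is prolonged by [m]. Since [m < n], the two cannot both be
    used, so they add exactly one. *)
Lemma longest_gtn_glue :
  longest gtn (w1 ++ [:: m, n & w2]) = (longest gtn w1).+1 + longest gtn w2.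
Proof.
rewrite -(cat_cons m [:: n]) catA longest_cat_rel //; congr addn.
apply/eqP; rewrite eqn_leq -addn1; apply/andP; split.
  apply: leq_trans (longest_cat_le _ _ _) _; rewrite leq_add2l.
  rewrite -cat1s longest_cat_nrel ?longest_seq1 //.
    by move=> b a c /=; lia.
  by move=> a b /[!inE] /eqP-> /eqP-> /=; lia.
rewrite -(longest_seq1 gtn m) -longest_cat_rel => [|a b /w1_mn a_mn /[!inE] /eqP->].
  by rewrite longest_mono // cat_subseq // sub1seq mem_head.
by move: a_mn => /=; lia.
Qed.

Lemma rises_word_glue :
  rises_word (w1 ++ [:: m, n & w2]) = (rises_word w1 + rises_word w2).+1.
Proof.
rewrite -(cat_cons m [:: n]) catA rises_word_cat // rises_word_cat_cons.
  by rewrite rises_word_cons2 rises_word_seq1 lt_mn addn0 addn1 addSn.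
by move=> a /w1_mn /andP[].
Qed.
End Glue.

(** * Decomposition of Motzkin words at the maximum *)

Section Words.
Local Notation permi w n := (perm_eq w (iota 0 n)).

Lemma glue_bounds (n : nat) (u1 u2 : seq nat) :
  permi u1 (size u1) -> permi u2 (size u2) -> size u1 + size u2 < n ->
  [/\ size u2 < n, {in [seq (size u2).+1 + i | i <- u1], forall a, size u2 < a < n}
    & {in u2, forall b, b < size u2}].
Proof.
move=> p1 p2 lt_n; split; first lia.
  by move=> _ /mapP[i + ->]; rewrite (perm_mem p1) mem_iota; lia.
by move=> b; rewrite (perm_mem p2) mem_iota.
Qed.

Lemma perm_iota_max (n : nat) (w1 w2 : seq nat) :
  permi (w1 ++ n :: w2) n.+1 = permi (w1 ++ w2) n.
Proof.
rewrite -cat1s perm_catCA -addn1 iotaD add0n.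
by rewrite perm_sym perm_catC perm_cat2l perm_sym.
Qed.

Lemma perm_glue (u1 u2 : seq nat) :
  permi u1 (size u1) -> permi u2 (size u2) ->
  permi (glue (size u1 + size u2).+1 u1 u2) (size u1 + size u2).+2.
Proof.
move=> p1 p2; rewrite /glue.
rewrite -(cat_rcons (size u2)) perm_iota_max cat_rcons -cat1s perm_catC -catA perm_catCA.
have -> : (size u1 + size u2).+1 = size u2 + (1 + size u1) by lia.
rewrite !iotaD add0n addn1 perm_cat // perm_cat2l.
by rewrite -[X in iota X (size u1)]addn0 iotaDl perm_map.
Qed.

(** In the glued form [0 < k] holds because the increasing pair [m], [n] must fit the bound [k.+1];
    [u1] gets the bound [k] because [n] prolongs its increasing subsequences. *)
Lemma words_max (k n : nat) (w : seq nat) :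
  w \in words k.+1 n.+1 ->
  (exists2 u, u \in words k.+1 n & w = n :: u) \/
  0 < k /\ (exists u1 u2, [/\ u1 \in words k (size u1),
    u2 \in words k.+1 (size u2), (size u1 + size u2).+1 = n & w = glue n u1 u2]).
Proof.
rewrite mem_words => /and3P[pw mw lw].
have : n \in w by rewrite (perm_mem pw) mem_iota ltnS leqnn.
move=> /splitPr Dw; case: Dw pw mw lw => w1 w2 pw mw lw.
have pw12 : permi (w1 ++ w2) n by rewrite -perm_iota_max.
have lt_n : {in w1 ++ w2, forall a, a < n}.
  by move=> a; rewrite (perm_mem pw12) mem_iota.
have uw : uniq (w1 ++ w2) by rewrite (perm_uniq pw12) iota_uniq.
have w12 := motzkin_word_max uw lt_n mw.
have [pw2 pw1] := perm_iota_split pw12 w12.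
(* Either [n] comes first, or it has a left neighbour [m]. *)
case/lastP: w1 => [|w1 m] in pw mw lw pw12 lt_n uw w12 pw1 pw2 *.
  left; exists w2 => //; rewrite mem_words pw12.
  have lt_w2 : {in [:: n] & w2, forall a b, b < a}.
    by move=> a b /[!inE] /eqP-> /lt_n.
  move: mw lw; rewrite !cat0s -cat1s motzkin_word_cat // => /andP[_ ->].
  rewrite longest_cat_nrel ?geq_max => [/andP[]//||a b a_n b_w2]; first exact: ltn_trans.
  by rewrite -leqNgt ltnW ?lt_w2.
right.
have lt_mn : m < n by rewrite lt_n // mem_cat mem_rcons mem_head.
rewrite cat_rcons in mw lw pw.
have mw1 : m \notin w1.
  by move: uw; rewrite cat_rcons uniq_catC /= mem_cat negb_or => /andP[/andP[]].
have gt_m := motzkin_word_min mw1 lt_mn mw.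
rewrite -cats1 in pw1.
(* A second split, with [[:: m]] as the lower part, pins [m] to the least value above [w2], namely
   [size w2]. *)
have [|pm pw1'] := perm_iota_split pw1.
  by move=> a b /gt_m ? /[!inE] /eqP->.
have Dm : m = size w2.
  by have := perm_mem pm m; rewrite mem_head mem_seq1 => /esym/eqP.
have [u1 pu1 Du1] := perm_iota_addP pw1'.
have w1_mn : {in w1, forall a, m < a < n}.
  by move=> a a_w1; rewrite gt_m // lt_n // mem_cat mem_rcons inE a_w1 orbT.
have w2_m : {in w2, forall b, b < m}.
  by move=> b b_w2; rewrite w12 // mem_rcons mem_head.
move: mw lw; rewrite motzkin_word_glue // longest_ltn_glue // !geq_max ltnS geq_max.
case/andP=> mw1' mw2 /andP[/andP[lw1 k_gt0] lw2].
split=> //; exists u1, w2.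
have Dw1 : w1 = [seq (size w2).+1 + i | i <- u1].
  by rewrite Du1; apply: eq_map => i; rewrite addn1.
have szu1 : size w1 = size u1 by rewrite Du1 size_map.
move: mw1' lw1.
rewrite Dw1 motzkin_word_map ?longest_map => [mu1 lu1|a b|a b]; try exact: ltn_add2l.
split; rewrite ?mem_words -?szu1 ?mu1 ?lu1 ?pu1 ?mw2 ?lw2 ?andbT //.
  by have := perm_size pw; rewrite size_iota size_cat /=; lia.
by rewrite /glue Dm cat_rcons.
Qed.

Lemma words_cons (k n : nat) (u : seq nat) :
  u \in words k.+1 n -> n :: u \in words k.+1 n.+1.
Proof.
rewrite !mem_words => /and3P[pu mu lu].
have lt_u : {in [:: n] & u, forall a b, b < a}.
  by move=> a b /[!inE] /eqP->; rewrite (perm_mem pu) mem_iota.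
rewrite -[n :: u]/([::] ++ n :: u) perm_iota_max pu cat0s -cat1s.
rewrite motzkin_word_cat // mu andbT.
rewrite longest_cat_nrel ?longest_seq1 ?geq_max ?lu // => [|a b a_n b_u].
  exact: ltn_trans.
by rewrite -leqNgt ltnW ?lt_u.
Qed.

Lemma words_glue (k : nat) (u1 u2 : seq nat) :
  0 < k -> u1 \in words k (size u1) -> u2 \in words k.+1 (size u2) ->
  glue (size u1 + size u2).+1 u1 u2 \in words k.+1 (size u1 + size u2).+2.
Proof.
rewrite !mem_words => k_gt0 /and3P[p1 m1 l1] /and3P[p2 m2 l2].
have [lt_n w1_mn w2_m] := glue_bounds p1 p2 (ltnSn _).
rewrite perm_glue // motzkin_word_glue // longest_ltn_glue // !geq_max ltnS geq_max.
rewrite motzkin_word_map ?longest_map => [|a b|a b]; try exact: ltn_add2l.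
by rewrite m1 m2 l1 l2 k_gt0.
Qed.

(** The position of the maximum reveals the size of [u1] and is never 0. This separates glued words
    from words [n :: u], and glued words with different cut sizes from each other. *)
Lemma index_glue (n : nat) (u1 u2 : seq nat) :
  permi u1 (size u1) -> permi u2 (size u2) -> size u1 + size u2 < n ->
  index n (glue n u1 u2) = (size u1).+1.
Proof.
move=> p1 p2 lt_n; have [lt_2n w1_n _] := glue_bounds p1 p2 lt_n.
rewrite index_cat ifN; last by apply/negP => /w1_n; rewrite ltnn andbF.
by rewrite size_map /= eqxx ltn_eqF // addn1.
Qed.

Lemma glue_inj (n : nat) (u1 u2 u1' u2' : seq nat) :
  size u1 = size u1' -> glue n u1 u2 = glue n u1' u2' -> u1 = u1' /\ u2 = u2'.
Proof.
move=> eq_sz /eqP; rewrite eqseq_cat ?size_map // => /andP[/eqP Du1 /eqP[sz2 Du2]].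
by split=> //; move: Du1; rewrite sz2 => /inj_map; apply; apply: addnI.
Qed.

Lemma size_words (k n : nat) (w : seq nat) : w \in words k n -> size w = n.
Proof. by rewrite mem_words => /andP[/perm_size-> _]; rewrite size_iota. Qed.

Lemma perm_words (k n : nat) (w : seq nat) :
  w \in words k n -> permi w (size w).
Proof.
move=> w_kn; rewrite (size_words w_kn).
by move: w_kn; rewrite mem_words => /andP[].
Qed.

Lemma words_uniq (k n : nat) : uniq (words k n).
Proof. by rewrite filter_uniq ?permutations_uniq. Qed.

Lemma words_rec (k n : nat) :
  perm_eq (words k.+1 n.+1)
    ([seq n :: u | u <- words k.+1 n] ++
     (if 0 < k then
        [seq glue n p.1 p.2 | l <- iota 0 n,
           p <- [seq (u1, u2) | u1 <- words k l, u2 <- words k.+1 (n - l.+1)]]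
      else [::])).
Proof.
(* Membership in the second list, unfolded; [l < n] makes the truncated difference [n - l.+1]
   exact. *)
have glueP l p : l \in iota 0 n ->
    p \in [seq (u1, u2) | u1 <- words k l, u2 <- words k.+1 (n - l.+1)] ->
  [/\ size p.1 = l, permi p.1 (size p.1), permi p.2 (size p.2),
    (size p.1 + size p.2).+1 = n &
    (p.1 \in words k (size p.1)) && (p.2 \in words k.+1 (size p.2))].
  rewrite mem_iota => /= lt_ln /allpairsP[[u1 u2] /= [u1w u2w -> /=]].
  rewrite (perm_words u1w) (perm_words u2w) (size_words u1w) (size_words u2w).
  by rewrite u1w u2w; split=> //; lia.
apply: uniq_perm; first exact: words_uniq.
  rewrite cat_uniq map_inj_uniq ?words_uniq => [|u u' []//].
  case: ifP => //= _; apply/andP; split.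
    apply/hasPn => _ /allpairsPdep[l [p [l_n p_l ->]]].
    have [sz_l p1 p2 sz_n _] := glueP _ _ l_n p_l; apply/negP => /mapP[u _ Du].
    have := @index_glue n _ _ p1 p2; rewrite Du /= eqxx => idx.
    by have := idx _; rewrite -sz_n => /(_ (ltnSn _)).
  apply: allpairs_uniq_dep; first exact: iota_uniq.
    move=> l _; apply: allpairs_uniq; rewrite ?words_uniq //.
    by move=> [? ?] [? ?] _ _ [-> ->].
  move=> _ _ /allpairsPdep[l [p [l_n p_l ->]]] /allpairsPdep[l' [p' [l'_n p_l' ->]]] /=.
  have [sz_l p1 p2 sz_n _] := glueP _ _ l_n p_l.
  have [sz_l' p1' p2' sz_n' _] := glueP _ _ l'_n p_l'.
  move=> eq_g; have eq_sz : size p.1 = size p'.1.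
    have := @index_glue n _ _ p1 p2; rewrite eq_g index_glue // -?sz_n' //.
    by rewrite sz_n' -sz_n => /(_ (ltnSn _)) [].
  have [eq1 eq2] := glue_inj eq_sz eq_g.
  have -> : p = p' by rewrite [p]surjective_pairing eq1 eq2 -surjective_pairing.
  by rewrite -sz_l -sz_l' eq_sz.
move=> w; rewrite mem_cat; apply/idP/orP => [/words_max|[/mapP[u]|]].
- case=> [[u u_w ->]|[k_gt0 [u1 [u2 [w1 w2 sz_n ->]]]]].
    by left; apply: map_f.
  right; rewrite k_gt0; apply/allpairsPdep; exists (size u1), (u1, u2).
  split=> //; first by rewrite mem_iota; lia.
  apply/allpairsP; exists (u1, u2); split=> //=.
  by have -> : n - (size u1).+1 = size u2 by lia.
- by move=> u_w ->; apply: words_cons.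
case: ifP => // k_gt0 /allpairsPdep[l [p [l_n p_l ->]]].
have [_ _ _ <- /andP[w1 w2]] := glueP _ _ l_n p_l.
exact: words_glue.
Qed.
End Words.

(** * Translation from permutations to words *)

Lemma motzkin_wordP (w : seq nat) :
  reflect
    ((forall i j k, i < j -> j < k -> k < size w ->
        ~~ (nth 0 w i < nth 0 w k < nth 0 w j)) /\
     (forall i j, i < j -> j.+1 < size w ->
        ~~ (nth 0 w i < nth 0 w j < nth 0 w j.+1)))
    (motzkin_word w).
Proof.
elim: w => [|a w IH] /=; first by left.
apply: (iffP and3P) => [[/(pairwiseP 0) pw /(sortedP 0) sw /IH[mw1 mw2]]|[mw1 mw2]].
  split=> [[|i] [|j] [|k] //|[|i] [|j] //]; rewrite ?ltnS => *; [|exact: mw1| |exact: mw2].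
    by apply: pw; rewrite ?inE //; lia.
  exact: sw.
split.
- apply/(pairwiseP 0) => i j; rewrite !inE => lt_i lt_j lt_ij.
  by apply: (mw1 0 i.+1 j.+1).
- by apply/(sortedP 0) => i lt_i; apply: (mw2 0 i.+1).
apply/IH; split=> [i j k ? ? ?|i j ? ?]; first exact: (mw1 i.+1 j.+1 k.+1).
exact: (mw2 i.+1 j.+1).
Qed.

Section PermutationWords.
Variable n : nat.
Implicit Types (s : 'S_n) (r : rel nat) (A : {set 'I_n}).

Definition word s : seq nat := [seq val (s i) | i <- enum 'I_n].

Lemma size_word s : size (word s) = n.
Proof. by rewrite size_map size_enum_ord. Qed.

Lemma nth_word s (i : 'I_n) : nth 0 (word s) i = s i.
Proof. by rewrite (nth_map i) ?size_enum_ord ?nth_ord_enum. Qed.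

Lemma motzkin_wordE s : motzkin_word (word s) = motzkin s.
Proof.
apply/motzkin_wordP/andP; rewrite size_word => -[avoid1 avoid2]; split.
- apply/'forall_'forall_forallP => i j k; rewrite -!nth_word.
  apply/and4P => -[lt_ij lt_jk lt_ik lt_kj].
  by have := avoid1 i j k lt_ij lt_jk (ltn_ord k); rewrite lt_ik lt_kj.
- apply/'forall_'forall_forallP => i j k; rewrite -!nth_word.
  apply/and4P => -[lt_ij /eqP Dk lt_ik lt_kj].
  by have := avoid2 i j lt_ij; rewrite -Dk lt_ik lt_kj ltn_ord => /(_ isT).
- move=> i j k lt_ij lt_jk lt_kn.
  have lt_jn := ltn_trans lt_jk lt_kn; have lt_in := ltn_trans lt_ij lt_jn.
  move/'forall_'forall_forallP: avoid1.
  move/(_ (Ordinal lt_in) (Ordinal lt_jn) (Ordinal lt_kn)).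
  by rewrite -!nth_word /= lt_ij lt_jk.
move=> i j lt_ij lt_jn.
have lt_jn' := ltnW lt_jn; have lt_in := ltn_trans lt_ij lt_jn'.
move/'forall_'forall_forallP: avoid2.
move/(_ (Ordinal lt_in) (Ordinal lt_jn') (Ordinal lt_jn)).
by rewrite -!nth_word /= lt_ij eqxx.
Qed.

(** A subsequence of [enum 'I_n] lists positions in increasing order, so it carries the same data as
    a set of positions; transitivity extends sortedness from neighbours to all pairs. *)
Lemma sorted_word_on s r (t : seq 'I_n) : transitive r ->
  subseq t (enum 'I_n) ->
  reflect {in t &, forall i j : 'I_n, i < j -> r (s i) (s j)}
          (sorted r [seq val (s i) | i <- t]).
Proof.
move=> r_tr sub_t; rewrite sorted_pairwise // pairwise_map.
have: pairwise (relpre val ltn) t.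
  apply: subseq_pairwise sub_t _; rewrite -pairwise_map val_enum_ord.
  by rewrite -sorted_pairwise ?iota_ltn_sorted //; apply: ltn_trans.
elim: t {sub_t} => [|a t IH] /=; first by left.
case/andP=> /allP lt_a /IH{}IH; apply: (iffP andP) => [[/allP r_a /IH r_t] i j|r_t].
  rewrite !inE => /predU1P[->|i_t] /predU1P[->|j_t].
  - by rewrite ltnn.
  - by move=> _; apply: r_a.
  - by have /= := lt_a i i_t; lia.
  - exact: r_t.
split; last by apply/IH => i j i_t j_t; apply: r_t; rewrite inE ?i_t ?j_t orbT.
by apply/allP => j j_t; apply: r_t (lt_a j j_t); rewrite inE ?eqxx ?j_t ?orbT.
Qed.

(** The inequality suits both uses: [has_increasing] asks for an exact cardinality, obtained by
    truncating a longest subsequence, and [lds] is a maximum. *)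
Lemma longest_word s r (m : nat) : transitive r ->
  reflect (exists2 A : {set 'I_n}, #|A| = m &
             [forall i in A, forall j in A, (i < j)%N ==> r (s i) (s j)])
          (m <= longest r (word s)).
Proof.
move=> r_tr; apply: (iffP idP) => [le_m|[A <- r_A]].
  have [u [/subseqP[b sz_b Du] ru sz_u]] := longest_ex r (word s).
  pose t := take m (mask b (enum 'I_n)).
  have sub_t : subseq t (enum 'I_n).
    by apply: subseq_trans (mask_subseq b _); apply: take_subseq.
  exists [set i in t].
    rewrite cardsE (card_uniqP _) ?(subseq_uniq sub_t) ?enum_uniq // size_takel //.
    by rewrite -(size_map (fun i => val (s i))) map_mask -/(word s) -Du sz_u.
  have /(sorted_word_on s r_tr sub_t) r_t : sorted r [seq val (s i) | i <- t].
    by rewrite map_take map_mask -/(word s) -Du take_sorted.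
  apply/'forall_implyP => i /[!inE] i_t; apply/'forall_implyP => j /[!inE] j_t.
  by apply/implyP; apply: r_t.
have sub_A : subseq (enum A) (enum 'I_n) by rewrite enumT filter_subseq.
rewrite cardE -(size_map (fun i => val (s i))).
apply: longest_ge; first exact: map_subseq.
apply/(sorted_word_on s r_tr sub_A) => i j; rewrite !mem_enum => i_A j_A.
by move/'forall_implyP: r_A => /(_ i i_A)/'forall_implyP/(_ j j_A)/implyP.
Qed.

Lemma longest_ltn_word s (m : nat) : has_increasing s m = (m <= longest ltn (word s)).
Proof.
apply/existsP/(longest_word s m ltn_trans) => -[A].
  by case/andP=> /eqP sz_A r_A; exists A.
by move=> sz_A r_A; exists A; rewrite sz_A eqxx.
Qed.

Lemma longest_gtn_word s : longest gtn (word s) = lds s.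
Proof.
have gtn_trans : transitive gtn by move=> b a c /=; lia.
apply/eqP; rewrite eqn_leq; apply/andP; split.
  have /(longest_word s _ gtn_trans)[A <- r_A] := leqnn (longest gtn (word s)).
  exact: (@leq_bigmax_cond _ (decreasing_on s) (fun A => #|A|)).
by apply/bigmax_leqP => A r_A; apply/(longest_word s _ gtn_trans); exists A.
Qed.

(** The map to words is injective and lands among the rearrangements; both sides have factorial of
    [n] elements, so it reaches all of them. *)
Lemma perm_word : perm_eq [seq word s | s : 'S_n] (permutations (iota 0 n)).
Proof.
have uw : uniq [seq word s | s : 'S_n].
  rewrite map_inj_uniq ?enum_uniq // => s s' eq_w; apply/permP => i; apply: val_inj.
  by rewrite /= -!nth_word eq_w.
apply: uniq_perm => //; first exact: permutations_uniq.
have [|//|_ //] := uniq_min_size uw (s2 := permutations (iota 0 n)).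
  move=> _ /mapP[s _ ->]; rewrite mem_permutations; apply: uniq_perm.
  - by rewrite map_inj_uniq ?enum_uniq // => i j /val_inj/perm_inj.
  - exact: iota_uniq.
  move=> j; rewrite mem_iota /=; apply/mapP/idP => [[i _ ->]|lt_jn]; first exact: ltn_ord.
  by exists (s^-1 (Ordinal lt_jn))%g; rewrite ?mem_enum ?permKV.
by rewrite size_map -cardE card_Sn size_permutations ?iota_uniq ?size_iota.
Qed.
End PermutationWords.

Lemma rises_wordE (n : nat) (s : 'S_n) : rises_word (word s) = rises s.
Proof.
rewrite /rises_word size_word /rises -sum1dep_card [RHS]big_mkcond /=.
case: n s => [|m] s; first by rewrite big_nil big_ord0.
(* The last position has no successor, so its term vanishes. *)
rewrite big_mkord [RHS]big_ord_recr /= ifF ?addn0; last first.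
  apply/negbTE/negP => /existsP[j /andP[/eqP/= Dj _]].
  by have := ltn_ord j; rewrite Dj ltnn.
apply: eq_bigr => i _; pose i1 := lift ord0 i.
rewrite -[i : nat]/(widen_ord (leqnSn m) i : nat) -[X in _ < nth _ _ X]/(i1 : nat).
rewrite !nth_word; case: existsP => [[j /andP[/eqP Dj lt_s]]|no_j].
  by have <- : j = i1 by [apply: val_inj]; rewrite lt_s.
by apply/eqP; rewrite eqb0; apply/negP => lt_s; case: no_j; exists i1; rewrite lt_s eqxx.
Qed.

Local Open Scope ring_scope.

(** * Recurrence for the coefficients of [B] *)

Definition weight (w : seq nat) : Zvy := v ^+ longest gtn w * y ^+ rises_word w.

Lemma coef_B (k n : nat) : B k n = \sum_(w <- words k n) weight w.
Proof.
rewrite big_filter -(perm_big _ (perm_word n)) big_map big_enum_cond /=.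
apply: eq_big => [s|s _]; first by rewrite motzkin_wordE longest_ltn_word -leqNgt.
by rewrite /weight longest_gtn_word rises_wordE.
Qed.

Lemma weight_cons (k n : nat) (u : seq nat) :
  u \in words k n -> weight (n :: u) = v * weight u.
Proof.
rewrite mem_words => /and3P[pu _ _].
have gt_u : {in [:: n] & u, forall a b, (b < a)%N}.
  by move=> a b /[!inE] /eqP->; rewrite (perm_mem pu) mem_iota.
rewrite /weight -cat1s longest_cat_rel // rises_word_cat //.
by rewrite longest_seq1 rises_word_seq1 add1n exprS mulrA.
Qed.

Lemma weight_glue (n : nat) (u1 u2 : seq nat) :
  perm_eq u1 (iota 0 (size u1)) -> perm_eq u2 (iota 0 (size u2)) ->
  (size u1 + size u2 < n)%N ->
  weight (glue n u1 u2) = v * y * (weight u1 * weight u2).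
Proof.
move=> p1 p2 lt_n; have [lt_2n w1_n w2_n] := glue_bounds p1 p2 lt_n.
rewrite /weight longest_gtn_glue // rises_word_glue //.
rewrite longest_map ?rises_word_map => [|a b|a b]; try exact: ltn_add2l.
by rewrite !exprD !exprS exprD; ring.
Qed.

Lemma coef_B0 (k : nat) : B k 0 = 1.
Proof.
have -> : B k 0 = \sum_(w <- [:: [::]]) weight w.
  by rewrite coef_B /words /= longest_nil.
by rewrite big_seq1 /weight longest_nil rises_word_nil mulr1.
Qed.

(** The first summand collects the words [n :: u], the second the glued words, with [l] the size of
    [u1]. *)
Lemma coef_BS (k n : nat) :
  B k.+1 n.+1 = v * B k.+1 n +
    (if (0 < k)%N then v * y * \sum_(l < n) B k l * B k.+1 (n - l.+1)%N else 0).
Proof.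
rewrite coef_B (perm_big _ (words_rec k n)) big_cat big_map; congr (_ + _).
  rewrite coef_B mulr_sumr big_seq [RHS]big_seq.
  by apply: eq_bigr => u; apply: weight_cons.
case: ifP => _; last exact: big_nil.
rewrite big_allpairs_dep -[X in iota 0 X]subn0 -/(index_iota 0 n) big_mkord.
rewrite mulr_sumr.
apply: eq_bigr => l _; rewrite big_allpairs !coef_B mulr_suml mulr_sumr.
rewrite big_seq [RHS]big_seq; apply: eq_bigr => u1 w1.
rewrite !mulr_sumr big_seq [RHS]big_seq; apply: eq_bigr => u2 w2.
apply: weight_glue; [exact: perm_words w1 | exact: perm_words w2|].
by rewrite (size_words w1) (size_words w2); have := ltn_ord l; lia.
Qed.

(** * Functional equations for the series *)

Lemma fps_coef_constM (R : comNzRingType) (c : R) (p : fps R) (n : nat) :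
  (fps_const c * p) n = c * p n.
Proof.
by rewrite fps_coefM big_ord_recl subn0 big1 ?addr0 // => i _; rewrite mul0r.
Qed.

Lemma fps_coef_xM0 (R : comNzRingType) (p : fps R) : (fps_x * p) 0%N = 0.
Proof. by rewrite fps_coefM big_ord1 mul0r. Qed.

Lemma fps_coef_xMS (R : comNzRingType) (p : fps R) (n : nat) :
  (fps_x * p) n.+1 = p n.
Proof.
rewrite fps_coefM !big_ord_recl /= mul0r add0r mul1r subSS subn0.
by rewrite big1 ?addr0 // => i _; rewrite mul0r.
Qed.

Lemma B1_eq : B 1 * (1 - fps_const v * fps_x) = 1.
Proof.
suff E : B 1 = 1 + fps_const v * (fps_x * B 1).
  by rewrite mulrBr mulr1 {1}E; ring.
apply: fpsP => -[|n]; rewrite fps_coefD fps_coef1 fps_coef_constM.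
  by rewrite coef_B0 fps_coef_xM0 mulr0 addr0.
by rewrite fps_coef_xMS coef_BS addr0 add0r.
Qed.

Lemma BS_eq (k : nat) : (0 < k)%N ->
  B k.+1 * (1 - fps_const v * fps_x - fps_const (v * y) * fps_x ^+ 2 * B k) = 1.
Proof.
move=> k_gt0.
(* The square of [fps_x] is written as two nested factors, to be peeled off one at a time. *)
suff E : B k.+1 = 1 + fps_const v * (fps_x * B k.+1) +
    fps_const (v * y) * (fps_x * (fps_x * (B k * B k.+1))).
  by rewrite 2!mulrBr mulr1 {1}E; ring.
apply: fpsP => -[|n]; rewrite !fps_coefD fps_coef1 !fps_coef_constM.
  by rewrite coef_B0 !fps_coef_xM0 !mulr0 !addr0.
rewrite !fps_coef_xMS coef_BS k_gt0 add0r; congr (_ + _ * _).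
(* A word of length 1 is not glued: the sum is empty. *)
case: n => [|n]; first by rewrite fps_coef_xM0 big_ord0.
by rewrite fps_coef_xMS fps_coefM.
Qed.

(** The hypothesis makes [b] a unit, so [1 / b] is a true quotient and not a default value. *)
Lemma divr1_mul_eq1 (R : comUnitRingType) (a b : R) : a * b = 1 -> a = 1 / b.
Proof.
move=> ab1; have Ub : b \is a GRing.unit by apply/unitrPr; exists a; rewrite mulrC.
by rewrite -ab1 mulrK.
Qed.

(** * Change of coefficients and the Chebyshev form *)

Lemma fps_mapM (R S : comNzRingType) (f : {rmorphism R -> S}) (p q : fps R) :
  fps_map f (p * q) = fps_map f p * fps_map f q.
Proof.
by apply: fpsP => n; rewrite /= rmorph_sum; apply: eq_bigr => i _; rewrite rmorphM.
Qed.

Lemma fps_mapB (R S : comNzRingType) (f : {rmorphism R -> S}) (p q : fps R) :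
  fps_map f (p - q) = fps_map f p - fps_map f q.
Proof. by apply: fpsP => n; rewrite /= rmorphB. Qed.

Lemma fps_map_const (R S : comNzRingType) (f : {rmorphism R -> S}) (c : R) :
  fps_map f (fps_const c) = fps_const (f c).
Proof. by apply: fpsP => -[|n] //=; rewrite rmorph0. Qed.

Lemma fps_map_x (R S : comNzRingType) (f : {rmorphism R -> S}) :
  fps_map f fps_x = fps_x.
Proof. by apply: fpsP => n /=; rewrite rmorph_nat. Qed.

Lemma fps_constM (R : comNzRingType) (a b : R) :
  fps_const (a * b) = fps_const a * fps_const b.
Proof. by apply: fpsP => -[|n]; rewrite fps_coef_constM //= mulr0. Qed.

(* With [2 z t = a], the continued fraction recurrence for [b] is the quotient of
   the Chebyshev recurrence by itself. *)
Lemma chebyshevU_ratio (F : fieldType) (a z t : F) (b : nat -> F) :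
  z != 0 -> 2%:R * t * z = a -> b 1%N * a = 1 ->
  (forall k, (0 < k)%N -> b k.+1 * (a - z ^+ 2 * b k) = 1) ->
  forall k, (chebyshevU F k.+1).[t] != 0 /\
    b k.+1 = (chebyshevU F k).[t] / (z * (chebyshevU F k.+1).[t]).
Proof.
move=> nz_z Da b1 bS.
have U1 : (chebyshevU F 1).[t] = 2%:R * t by rewrite /= hornerZ hornerX.
have US k : (chebyshevU F k.+2).[t] =
    2%:R * t * (chebyshevU F k.+1).[t] - (chebyshevU F k).[t].
  by rewrite [chebyshevU F k.+2]/= hornerD hornerN hornerM hornerZ hornerX.
have nz_r (c d : F) : c * d = 1 -> d != 0.
  by move=> cd1; apply: contra_eq_neq cd1 => ->; rewrite mulr0 eq_sym oner_eq0.
elim=> [|k [nz_U IH]].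
  rewrite U1 [(chebyshevU F 0).[t]]hornerC (divr1_mul_eq1 b1) -Da [z * _]mulrC.
  by split=> //; apply: contraNneq (nz_r _ _ b1); rewrite -Da => ->; rewrite mul0r.
have {bS} := bS k.+1 isT.
(* Over the common denominator, [a = 2 t z] and the induction hypothesis produce the right side of
   the Chebyshev recurrence [US]. *)
have -> : a - z ^+ 2 * b k.+1 = z * (chebyshevU F k.+2).[t] / (chebyshevU F k.+1).[t].
  by rewrite US IH -Da; field; rewrite nz_U nz_z.
(* A factor of a product equal to 1 is nonzero, which gives the nonvanishing of the next Chebyshev
   value. *)
move=> bU; have := nz_r _ _ bU; rewrite !mulf_eq0 !negb_or => /andP[/andP[_ nz_US] _].
split=> //; rewrite (divr1_mul_eq1 bU); field.
by rewrite nz_z nz_US nz_U.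
Qed.

Theorem theorem2p3 :
  let vx : fps Zvy := fps_const v * fps_x in
  let vyx2 : fps Zvy := fps_const (v * y) * fps_x ^+ 2 in
  [/\ B 1 = 1 / (1 - vx),
      forall k : nat, (1 < k)%N -> B k = 1 / (1 - vx - vyx2 * B k.-1),
      forall k : nat, (0 < k)%N -> B k = 1 / nested_frac (1 - vx) vyx2 k.-1
    & forall (k : nat) (L : fieldType) (f : {rmorphism Zvy -> L})
        (sqrt_vy : L),
        (0 < k)%N -> injective f -> sqrt_vy ^+ 2 = f (v * y) ->
        let x : {fraction (fps L)} := tofrac fps_x in
        let v' : {fraction (fps L)} := tofrac (fps_const (f v)) in
        let s : {fraction (fps L)} := tofrac (fps_const sqrt_vy) in
        let t : {fraction (fps L)} := (1 - v' * x) / (2%:R * x * s) in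
        tofrac (fps_map f (B k)) =
          (chebyshevU _ k.-1).[t] / (x * s * (chebyshevU _ k).[t])].
Proof.
move=> vx vyx2.
have B1 : B 1 = 1 / (1 - vx) := divr1_mul_eq1 B1_eq.
have BS k : (1 < k)%N -> B k = 1 / (1 - vx - vyx2 * B k.-1).
  move=> k_gt1; rewrite -{1}(ltn_predK k_gt1).
  by apply/divr1_mul_eq1/BS_eq; rewrite -ltnS (ltn_predK k_gt1).
have Bfrac k : B k.+1 = 1 / nested_frac (1 - vx) vyx2 k.
  elim: k => [|k IH]; first exact: B1.
  (* Turning [vyx2 * (1 / d)] into [vyx2 / d] exposes the next level of [nested_frac]. *)
  rewrite (BS k.+2 isT) [k.+2.-1]/= IH (div1r (nested_frac _ _ k)).
  exact: erefl.
split=> [|k|k k_gt0|k L f sqrt_vy k_gt0 inj_f Dsqrt x v' s t].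
- exact: B1.
- exact: BS.
- by rewrite -{1}(prednK k_gt0); apply: Bfrac.
rewrite -{1 3}(prednK k_gt0).
have nz_const (c : L) : c != 0 -> tofrac (fps_const c) != 0.
  move=> nz_c; rewrite tofrac_eq0; apply: contraNneq nz_c.
  by move/(congr1 (fun p : fps L => p 0%N)) => /= ->.
have nz_x : x != 0.
  rewrite tofrac_eq0; apply/eqP => /(congr1 (fun p : fps L => p 1%N)) /eqP.
  by rewrite /= oner_eq0.
have nz_f a : a != 0 -> f a != 0.
  by apply: contra_neq => fa0; apply: inj_f; rewrite fa0 rmorph0.
have nz_X i : ('X_i : Zvy) != 0 by rewrite -msize_poly_eq0 msizeX.
have nz_s : s != 0.
  by apply: nz_const; rewrite -sqrf_eq0 Dsqrt nz_f // mulf_neq0 ?nz_X.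
(* The element 2 is the image of a nonzero constant of [Zvy] under the injective [f]. *)
have nz_2 : 2%:R != 0 :> {fraction (fps L)}.
  have -> : 2%:R = tofrac (fps_const (f 2%:R)) :> {fraction (fps L)}.
    rewrite rmorph_nat !mulr2n -tofrac1 -tofracD; congr tofrac.
    by apply: fpsP => -[|n] /=; rewrite ?addr0.
  apply/nz_const/nz_f.
  by rewrite -mpolyC_nat mpolyC_eq0.
have f1 : fps_map f 1 = 1.
  by apply: fpsP => -[|n] /=; rewrite ?rmorph1 ?rmorph0.
pose b i := tofrac (fps_map f (B i)).
have bM i d : B i * d = 1 -> b i * tofrac (fps_map f d) = 1.
  by move=> Bd; rewrite -tofracM -fps_mapM Bd f1 tofrac1.
have fa : tofrac (fps_map f (1 - vx)) = 1 - v' * x.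
  by rewrite fps_mapB f1 fps_mapM fps_map_const fps_map_x tofracB tofrac1 tofracM.
(* Here [z] is [x * s], whose square is the image of [vyx2], and [2 t z] is [1 - v' * x]. As [x] is
   not a unit among series, the fraction field is needed to divide by [z]. *)
have [|||i i_gt0|] := @chebyshevU_ratio _ (1 - v' * x) (x * s) t b _ _ _ _ k.-1; last by [].
- exact: mulf_neq0 nz_x nz_s.
- rewrite /t mulrAC mulrC [2%:R * (x * s)]mulrA.
  exact: divfK (mulf_neq0 (mulf_neq0 nz_2 nz_x) nz_s) _.
- by rewrite -fa; apply/bM/B1_eq.
have := bM _ _ (BS_eq i_gt0); rewrite fps_mapB tofracB fa !fps_mapM.
rewrite fps_map_const fps_map_x -Dsqrt !fps_constM !tofracM.
by rewrite -/x -/s -/(b i) exprMn [x ^+ 2 * _]mulrC.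
Qed.
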